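(* Let $G$ be a graph with no isolated vertices, let $r\ge 3$, and suppose $\mathcal{PD}^{TAR}(K_{1,r})\cong\mathcal{PD}^{TAR}(G)$. Then $G\cong K_{1,r}$.
   Context: Graphs are finite and simple. For a graph $G$ and a non-empty $S\subseteq V(G)$ define $P^0[S]=S$, $P^1[S]=N[S]$ (the union of the closed neighborhoods of vertices of $S$), and for $i\ge 2$, $P^i[S]=P^{i-1}[S]\cup\{u: N_G(v)\setminus P^{i-1}[S]=\{u\}\text{ for some }v\in P^{i-1}[S]\}$. $S$ is a power dominating set if $P^t[S]=V(G)$ for some $t$. The token addition and removal (TAR) reconfiguration graph $\mathcal{PD}^{TAR}(G)$ has as vertices all power dominating sets of $G$, two of them adjacent if and only if one is obtained from the other by adding or removing a single vertex. *)

(* Defs.v *)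
From mathcomp Require Import all_boot.

Set Implicit Arguments.
Unset Strict Implicit.
Unset Printing Implicit Defensive.

Record sgraph := SGraph {
  vertex :> finType;
  adj : rel vertex;
  adj_sym : symmetric adj;
  adj_irrefl : irreflexive adj
}.

Definition graph_iso (G H : sgraph) : Prop :=
  exists f : G -> H, bijective f /\ forall x y : G, adj (f x) (f y) = adj x y.

Definition no_isolated_vertices (G : sgraph) : Prop :=
  forall x : G, exists y : G, adj x y.

Section CompleteBipartite.
Variables m n : nat.

Definition complete_bipartite_adj : rel ('I_m + 'I_n)%type :=
  fun x y => match x, y with
             | inl _, inr _ | inr _, inl _ => true
             | _, _ => false
             end.

Fact complete_bipartite_sym : symmetric complete_bipartite_adj.
Proof. by case=> x; case=> y. Qed.

Fact complete_bipartite_irrefl : irreflexive complete_bipartite_adj.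
Proof. by case. Qed.

Definition complete_bipartite : sgraph :=
  SGraph complete_bipartite_sym complete_bipartite_irrefl.

End CompleteBipartite.

Section PowerDomination.
Variable G : sgraph.
Implicit Types (S T A : {set G}) (u v : G).

Definition neigh v : {set G} := [set u | adj v u].

Definition closed_neigh v : {set G} := v |: neigh v.

Definition closed_neigh_set S : {set G} := \bigcup_(v in S) closed_neigh v.

Definition force_step A : {set G} :=
  A :|: [set u | [exists v in A, neigh v :\: A == [set u]]].

Fixpoint observed S (i : nat) : {set G} :=
  if i is j.+1 then
    if j is 0 then closed_neigh_set S else force_step (observed S j)
  else S.

(* The bound on t makes this a boolean predicate; it loses no generality, see
   [power_dominatingP]. *)
Definition power_dominating S : bool :=
  (S != set0) && [exists t : 'I_#|G|.+1, observed S t == [set: G]].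

Lemma observed_subS S i : observed S i \subset observed S i.+1.
Proof.
case: i => [|i] /=; last exact: subsetUl.
by apply/subsetP=> v vS; apply/bigcupP; exists v; rewrite // setU11.
Qed.

Lemma observed_stable S i :
  observed S i.+1 = observed S i -> observed S i.+2 = observed S i.+1.
Proof.
case: i => [|i] E; last exact: (congr1 force_step E).
have NS : closed_neigh_set S = S by [].
rewrite [LHS]/= [RHS]/= NS; apply/setUidPl.
apply/subsetP=> u; rewrite inE => /existsP[v /andP[vS /eqP Eu]].
have: u \in neigh v :\: S by rewrite Eu set11.
move/setDP=> [uv /negP[]]; rewrite -NS.
by apply/bigcupP; exists v; rewrite ?setU1r.
Qed.

Lemma power_dominatingP S :
  reflect (S != set0 /\ exists t, observed S t = [set: G]) (power_dominating S).
Proof.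
apply: (iffP andP) => -[S0].
  by case/existsP=> t /eqP Et; split=> //; exists t.
case=> t Et; split=> //.
have mono i j : i <= j -> observed S i \subset observed S j.
  move/subnK <-; elim: (j - i) => [|k IHk] //.
  exact: subset_trans IHk (observed_subS S _).
have stab i k : observed S i.+1 = observed S i ->
    observed S (i + k) = observed S i.
  move=> Ei; suff: observed S (i + k) = observed S i /\
                   observed S (i + k).+1 = observed S (i + k) by case.
  elim: k => [|k [IH1 IH2]]; first by rewrite addn0.
  by rewrite addnS; split; [rewrite IH2 | exact: observed_stable].
have grow i : (i <= #|observed S i|) \/
    (exists2 j, j < i & observed S j.+1 = observed S j).
  elim: i => [|i [IHi|[j lt_ji Ej]]]; first by left.
    case: (eqVneq (observed S i.+1) (observed S i)) => [Ei|Ni].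
      by right; exists i.
    left; apply: leq_ltn_trans IHi _; apply: proper_card.
    by rewrite properEneq eq_sym Ni observed_subS.
  by right; exists j => //; apply: ltnW.
have ET k : t <= k -> observed S k = [set: G].
  by move=> tk; apply/eqP; rewrite eqEsubset subsetT -Et mono.
apply/existsP; case: (grow #|G|) => [cG|[j jG Ej]].
  exists ord_max => /=; rewrite eqEcard subsetT /=.
  by rewrite cardsT.
have jG1 : j < #|G|.+1 by apply: ltnW.
by exists (Ordinal jG1); rewrite /= -(stab j t Ej) ET // leq_addl.
Qed.

Definition PDset : finType := {S : {set G} | power_dominating S}.

Definition tar_adj : rel PDset := fun X Y =>
  [exists v : G,
    (v \notin val X) && (val Y == v |: val X)
    || (v \in val X) && (val Y == val X :\ v)].

Fact tar_sym : symmetric tar_adj.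
Proof.
suff half (X Y : PDset) : tar_adj X Y -> tar_adj Y X.
  by move=> X Y; apply/idP/idP; apply: half.
case/existsP=> v /orP[] /andP[vX /eqP E]; apply/existsP; exists v; rewrite !E.
  by rewrite setU11 setU1K // eqxx orbT.
by rewrite !inE eqxx setD1K // eqxx.
Qed.

Fact tar_irrefl : irreflexive tar_adj.
Proof.
move=> X; apply/negbTE/negP; rewrite /tar_adj => /existsP[v /orP[] /andP[vX /eqP E]].
  by move: vX; rewrite E setU11.
by move: vX; rewrite E !inE eqxx.
Qed.

Definition PD_TAR : sgraph := SGraph tar_sym tar_irrefl.

End PowerDomination.

(* Main.v *)
Require Import Defs.
From mathcomp Require Import all_boot.

Set Implicit Arguments.
Unset Strict Implicit.
Unset Printing Implicit Defensive.

(** The power dominating sets of the star with centre c and r leaves are the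
    sets containing c, which form a cube of dimension r in the TAR graph, and
    r + 1 further sets that miss c and at most one leaf; these span a star
    centred at the set of all leaves.

    Both halves can be recognised in the TAR graph of G.  Without isolated
    vertices, the full vertex set has the largest possible degree, the order
    of the graph, so G has r + 1 vertices ([order_le_of_tar_iso]).  A cube of
    dimension r lying in the cube of all subsets of V(G) is a face of the
    latter ([cube_embedding]), so it consists of all sets that contain some
    vertex v or of all sets that avoid it; since the empty set is not power
    dominating, the image of the first half consists of the sets containing
    v.  The sets missing v are thus the image
    of the second half, where any two edges meet ([star_edge_off_center]).  If
    some set missing v and two more vertices were power dominating, it would
    produce two disjoint edges among the sets missing v, by monotonicity.

    So {v} is power dominating in G and no set missing v and two other
    vertices is.  That forces G to be a star centred at v
    ([star_of_power_dominating_sets]), because a set that dominates all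
    vertices except one is power dominating. *)

(** * Power domination *)

Section PowerDomination.
Variable G : sgraph.
Implicit Types (S T C : {set G}) (u v x y : G).

(** The vertex x left undominated is the last one, so any of its neighbours
    forces it. *)
Lemma power_dominating_all_but_one S x :
  no_isolated_vertices G ->
  (forall y, y \notin S -> y != x -> exists2 z, z \in S & adj y z) ->
  power_dominating S.
Proof.
move=> isoG domS.
have dom y : y != x -> y \in closed_neigh_set S.
  move=> yx; apply/bigcupP; case yS: (y \in S); first by exists y; rewrite ?setU11.
  have [z zS yz] := domS y (negbT yS) yx.
  by exists z; rewrite // !inE adj_sym yz orbT.
have [y xy] := isoG x.
have yx : y != x by apply: contraTneq xy => ->; rewrite adj_irrefl.
apply/power_dominatingP; split.
  have /bigcupP[z zS _] := dom y yx.
  by apply/set0Pn; exists z.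
exists 2; apply/setP=> u; rewrite [RHS]inE /= inE.
have [-> | ux] := eqVneq u x; last by rewrite dom.
case xN: (x \in closed_neigh_set S) => //=; rewrite inE.
apply/existsP; exists y; rewrite dom //=.
apply/eqP/setP=> z; rewrite !inE.
have [-> | zx] := eqVneq z x; first by rewrite xN adj_sym xy.
by rewrite dom.
Qed.

Lemma force_step_mono S T : S \subset T -> force_step S \subset force_step T.
Proof.
move=> ST; apply/subsetP=> u; rewrite !inE => /orP[uS|].
  by rewrite (subsetP ST).
case/existsP=> v /andP[vS /eqP Nv].
case uT: (u \in T) => //=; apply/existsP; exists v.
rewrite (subsetP ST) //= eqEsubset -{1}Nv setDS //=.
have: u \in neigh v :\: S by rewrite Nv set11.
by rewrite sub1set !inE uT => /andP[].
Qed.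

Lemma power_dominatingS S T :
  S \subset T -> power_dominating S -> power_dominating T.
Proof.
move=> ST /power_dominatingP[S0 [t St]]; apply/power_dominatingP; split.
  by apply: contraNneq S0 => T0; rewrite T0 subset0 in ST.
exists t; apply/eqP; rewrite -subTset -St.
elim: t {St} => [|[|t] IHt] //=; last exact: force_step_mono.
by apply/bigcupsP=> v vS; apply: (bigcup_sup v); rewrite ?(subsetP ST).
Qed.

(** Observation never leaves a union of connected components. *)
Lemma observed_component S C t :
  (forall x y, x \in C -> adj x y -> y \in C) ->
  S \subset C -> observed S t \subset C.
Proof.
move=> clC SC; elim: t => [|[|t] IHt] //=; apply/subsetP=> u.
  case/bigcupP=> v vS; rewrite !inE => /predU1P[->|]; first exact: (subsetP SC).
  by apply: clC; apply: (subsetP SC).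
rewrite !inE => /orP[/(subsetP IHt) //|/existsP[v /andP[vO /eqP Nv]]].
have: u \in neigh v :\: observed S t.+1 by rewrite Nv set11.
by rewrite !inE => /andP[_]; apply: clC; apply: (subsetP IHt).
Qed.

End PowerDomination.

(** Two adjacent vertices a, b other than v would be fatal: for w outside
    {v, a, b}, the complement of {v, a, w} dominates a through b; if it also
    dominated v or w, only one vertex would be left and it would be power
    dominating.  So v and w have no neighbour in that complement; likewise
    for the complement of {v, b, w}.  Hence v and w are adjacent to nothing but each other, and {v} never
    observes a. *)
Lemma star_of_power_dominating_sets (G : sgraph) (v : G) :
  no_isolated_vertices G -> 3 < #|G| -> power_dominating [set v] ->
  (forall u w, u != v -> w != v -> u != w ->
     ~~ power_dominating (~: [set v; u; w])) ->
  forall x y : G, adj x y = (x == v) (+) (y == v).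
Proof.
move=> isoG G4 PDv notPD.
have noedge a b : a != v -> b != v -> ~~ adj a b.
  move=> av bv; apply/negP=> ab.
  have anb : a != b by apply: contraTneq ab => ->; rewrite adj_irrefl.
  have [w] : exists w, w \in ~: [set v; a; b].
    apply/set0Pn; rewrite -card_gt0 -(ltn_add2l #|[set v; a; b]|) cardsC addn0.
    apply: leq_ltn_trans G4; apply: leq_trans (leq_card_setU _ _) _.
    by rewrite cards2 cards1; case: (_ == _).
  rewrite !inE !negb_or -andbA => /and3P[wv wa wb].
  have N p q : p != v -> q != v -> p != q -> w != p -> w != q -> adj p q ->
      forall z, (adj v z -> z \in [set p; w]) /\ (adj w z -> z \in [set p; v]).
    move=> pv qv pq wp wq Apq z.
    have nPD : ~~ power_dominating (~: [set v; p; w]) by rewrite notPD // eq_sym.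
    have qS : q \in ~: [set v; p; w].
      by rewrite !inE !negb_or qv eq_sym pq eq_sym wq.
    split=> Az; apply: contraNT nPD; rewrite !inE negb_or => /andP[zp zo].
    - have zv : z != v by apply: contraTneq Az => ->; rewrite adj_irrefl.
      apply: (@power_dominating_all_but_one _ _ w) => // y.
      rewrite !inE negbK -orbA => /or3P[] /eqP-> yw.
      + by exists z; rewrite // !inE !negb_or zv zp zo.
      + by exists q.
      + by rewrite eqxx in yw.
    - have zw : z != w by apply: contraTneq Az => ->; rewrite adj_irrefl.
      apply: (@power_dominating_all_but_one _ _ v) => // y.
      rewrite !inE negbK -orbA => /or3P[] /eqP-> yv.
      + by rewrite eqxx in yv.
      + by exists q.
      + by exists z; rewrite // !inE !negb_or zo zp zw.
  have Na := N a b av bv anb wa wb ab.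
  have bna : b != a by rewrite eq_sym.
  have ba : adj b a by rewrite adj_sym.
  have Nb := N b a bv av bna wb wa ba.
  have closed x y : x \in [set v; w] -> adj x y -> y \in [set v; w].
    have [[Nav Naw] [Nbv Nbw]] := (Na y, Nb y).
    rewrite !inE => /orP[] /eqP-> A.
      move: (Nav A) (Nbv A); rewrite !inE => /orP[/eqP->|->]; rewrite ?orbT //.
      by rewrite (negPf anb) eq_sym (negPf wa).
    move: (Naw A) (Nbw A); rewrite !inE => /orP[/eqP->|->] //.
    by rewrite (negPf anb) (negPf av).
  have /power_dominatingP[_ [t Ot]] := PDv.
  have : [set v] \subset [set v; w] by rewrite subsetUl.
  move/(observed_component t closed)/subsetP/(_ a).
  rewrite Ot !inE => /(_ isT).
  by rewrite (negPf av) eq_sym (negPf wa).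
have toV x : x != v -> adj x v.
  move=> xv; have [y xy] := isoG x.
  have [<- //|yv] := eqVneq y v.
  by rewrite (negPf (noedge x y xv yv)) in xy.
move=> x y; have [->|xv] := eqVneq x v; have [->|yv] := eqVneq y v => /=.
- exact: adj_irrefl.
- by rewrite adj_sym toV.
- exact: toV.
- exact/negbTE/noedge.
Qed.

(** * Cubes of subsets *)

Definition toggle (T : finType) (A : {set T}) (x : T) : {set T} :=
  [set y | (y == x) (+) (y \in A)].

Lemma toggle_inj (T : finType) (A : {set T}) : injective (toggle A).
Proof.
move=> x y /setP/(_ x); rewrite !inE eqxx /=.
by case: eqVneq => //; case: (x \in A).
Qed.

Lemma toggle_setU1 (T : finType) (A : {set T}) x :
  x \notin A -> toggle A x = x |: A.
Proof.
move=> xA; apply/setP=> y; rewrite !inE.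
by case: eqVneq => // ->; rewrite (negPf xA).
Qed.

Lemma toggle_setD1 (T : finType) (A : {set T}) x :
  x \in A -> toggle A x = A :\ x.
Proof.
by move=> xA; apply/setP=> y; rewrite !inE; case: eqVneq => // ->; rewrite xA.
Qed.

(** Two neighbours of a vertex of a cube have exactly one other common
    neighbour, so the images of the singletons determine all the others, by
    induction on the cardinality. *)
Lemma cube_embedding (I T : finType) (g : {set I} -> {set T}) :
  injective g -> (forall A i, exists x, g (toggle A i) = toggle (g A) x) ->
  exists2 s : I -> T, injective s &
    forall A x, (x \in g A) = (x \in g set0) (+) (x \in s @: A).
Proof.
move=> g_inj gE.
have /fin_all_exists[s sE] : forall i, exists x, g (toggle set0 i) = toggle (g set0) x.
  exact: gE.
have s_inj : injective s.
  by move=> i j Es; apply: (@toggle_inj _ set0); apply: g_inj; rewrite !sE Es.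
exists s => // A; elim: {A}_.+1 {-2}A (ltnSn #|A|) => // n IHn A An x.
have [->|/set0Pn[a aA]] := eqVneq A set0; first by rewrite imset0 inE addbF.
have imD (b : I) (B : {set I}) : b \in B -> forall y,
    (y \in s @: (B :\ b)) = (y != s b) && (y \in s @: B).
  move=> bB y; apply/imsetP/andP.
    case=> i; rewrite !inE => /andP[ib iB] ->.
    by rewrite (inj_eq s_inj) imset_f.
  by case=> yb /imsetP[i iB Ey]; exists i => //; rewrite !inE iB andbT -(inj_eq s_inj) -Ey.
have [E|/set0Pn[b bAa]] := eqVneq (A :\ a) set0.
  have -> : A = toggle set0 a.
    by rewrite toggle_setU1 ?inE // setUC -E setUC setD1K.
  rewrite sE inE addbC; congr (_ (+) _).
  by rewrite toggle_setU1 ?inE // setU0 imset_set1 inE.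
have /andP[ba bA] : (b != a) && (b \in A) by move: bAa; rewrite !inE.
have aAb : a \in A :\ b by rewrite !inE eq_sym ba.
have small (c : I) (B : {set I}) : B \subset A :\ c -> c \in A -> #|B| < n.
  move=> BA cA; apply: leq_ltn_trans (subset_leq_card BA) _.
  by rewrite (cardsD1 c) cA in An.
have IHa := IHn (A :\ a) (small _ _ (subxx _) aA).
have IHb := IHn (A :\ b) (small _ _ (subxx _) bA).
have IHab := IHn (A :\ a :\ b) (small _ _ (subsetDl _ _) aA).
have [p gp] := gE (A :\ a) a; have [q gq] := gE (A :\ b) b.
have tK c : c \in A -> toggle (A :\ c) c = A.
  by move=> cA; rewrite toggle_setU1 ?setD1K // !inE eqxx.
rewrite tK // in gp; rewrite tK // in gq.
have sab : (s a == s b) = false by rewrite (inj_eq s_inj) eq_sym (negPf ba).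
(* The sets g (A :\ a) and g (A :\ b) disagree at s a, so one of them is
   toggled there to reach the common value g A. *)
have : (s a == p) || (s a == q).
  have /setP/(_ (s a)) : toggle (g (A :\ a)) p = toggle (g (A :\ b)) q by rewrite -gp.
  rewrite !inE IHa IHb !imD // eqxx sab imset_f //=.
  by case: (_ == p); case: (_ == q); case: (s a \in g set0).
case/orP=> /eqP E.
  rewrite gp -E inE IHa imD //.
  by case: eqVneq => [->|] //=; rewrite imset_f //; case: (s a \in g set0).
(* Otherwise q = s a leads back to the fourth corner of the square. *)
have : A = A :\ a :\ b.
  apply: g_inj; apply/setP=> y; rewrite gq -E inE IHb IHab !imD //.
  case: eqVneq => [->|_] /=; last by [].
  by rewrite sab imset_f //=; case: (s a \in g set0).
by move/setP/(_ a); rewrite !inE eqxx aA andbF.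
Qed.

(** * Reconfiguration graphs *)

Definition tar_vertex (G : sgraph) (S : {set G}) (PDS : power_dominating S) :
    PD_TAR G :=
  exist (fun S : {set G} => power_dominating S) S PDS.

Lemma tar_adjP (G : sgraph) (X Y : PD_TAR G) :
  reflect (exists u, val Y = toggle (val X) u) (adj X Y).
Proof.
apply: (iffP existsP) => -[u].
  by case/orP=> /andP[uX /eqP->]; exists u; rewrite ?(toggle_setD1 uX) ?toggle_setU1.
move=> ->; exists u; case uX: (u \in val X).
  by rewrite toggle_setD1 // eqxx.
by rewrite toggle_setU1 ?uX // eqxx.
Qed.

Lemma tar_degree_le (G : sgraph) (X : PD_TAR G) : #|neigh X| <= #|G|.
Proof.
rewrite -(card_imset _ val_inj).
apply: leq_trans (leq_imset_card (toggle (val X)) G).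
apply: subset_leq_card; apply/subsetP=> _ /imsetP[Y + ->].
by rewrite inE => /tar_adjP[u ->]; apply: imset_f.
Qed.

Lemma power_dominating_full (G : sgraph) (x : G) :
  no_isolated_vertices G -> power_dominating [set: G].
Proof.
by move=> isoG; apply: (@power_dominating_all_but_one _ _ x) => // y; rewrite inE.
Qed.

Lemma power_dominating_setC1 (G : sgraph) (x : G) :
  no_isolated_vertices G -> power_dominating [set~ x].
Proof.
move=> isoG; apply: (@power_dominating_all_but_one _ _ x) => // y.
by rewrite !inE negbK => ->.
Qed.

Lemma tar_degree_full (G : sgraph) (X : PD_TAR G) :
  no_isolated_vertices G -> val X = setT -> #|G| <= #|neigh X|.
Proof.
move=> isoG XT.
pose F (x : G) : PD_TAR G := tar_vertex (power_dominating_setC1 x isoG).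
have F_inj : injective F.
  by move=> x y /(congr1 val)/=/setC_inj/set1_inj.
rewrite -cardsT -(card_imset _ F_inj); apply: subset_leq_card.
apply/subsetP=> _ /imsetP[x _ ->]; rewrite inE; apply/tar_adjP; exists x.
by rewrite XT toggle_setD1 ?inE // setTD.
Qed.

(** The full vertex set attains the maximum degree of the reconfiguration
    graph, which is the order of the underlying graph. *)
Lemma order_le_of_tar_iso (G H : sgraph) (f : PD_TAR G -> PD_TAR H) (x : G) :
  no_isolated_vertices G -> injective f ->
  (forall X Y, adj (f X) (f Y) = adj X Y) -> #|G| <= #|H|.
Proof.
move=> isoG f_inj fA.
pose X : PD_TAR G := tar_vertex (power_dominating_full x isoG).
apply: leq_trans (tar_degree_full isoG (erefl : val X = _)) _.
apply: leq_trans (tar_degree_le (f X)); rewrite -(card_imset _ f_inj).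
apply: subset_leq_card; apply/subsetP=> _ /imsetP[Y + ->].
by rewrite !inE fA.
Qed.

(** * Stars *)

Section Star.
Variable r : nat.
Let K := complete_bipartite 1 r.
Let center : K := inl ord0.

Lemma star_vertexE (x : K) : x != center -> exists i, x = inr i.
Proof. by case: x => [i|i]; [rewrite (ord1 i) eqxx | exists i]. Qed.

Lemma star_no_isolated : 0 < r -> no_isolated_vertices K.
Proof. by move=> r0 [i|i]; [exists (inr (Ordinal r0)) | exists center]. Qed.

Lemma star_center_power_dominating (S : {set K}) :
  center \in S -> power_dominating S.
Proof.
move=> cS; apply/power_dominatingP; split; first by apply/set0Pn; exists center.
exists 1; apply/setP=> x; rewrite [RHS]inE; apply/bigcupP; exists center => //.
by rewrite !inE; case: x => [i|i]; rewrite ?(ord1 i) ?eqxx.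
Qed.

(** Two unobserved leaves block each other: only the centre could force
    them. *)
Lemma star_off_center_not_power_dominating (S : {set K}) (x y : K) :
  center \notin S -> x \notin S -> y \notin S ->
  x != center -> y != center -> x != y -> ~~ power_dominating S.
Proof.
move=> cS xS yS /star_vertexE[i Ex] /star_vertexE[j Ey] xy; subst x y.
apply/negP=> /power_dominatingP[_ [t]].
have [] : inr i \notin observed S t /\ inr j \notin observed S t.
  elim: t => [|[|t] [IHi IHj]] //.
    have leafN k : (inr k : K) \notin S -> (inr k : K) \notin closed_neigh_set S.
      move=> kS; apply/bigcupP=> -[v vS]; rewrite !inE => /orP[/eqP E|].
        by rewrite E vS in kS.
      by case: v vS => // o; rewrite (ord1 o) (negPf cS).
    by split; apply: leafN.
  have leafN k l : k != l -> (inr k : K) \notin observed S t.+1 ->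
      (inr l : K) \notin observed S t.+1 -> (inr k : K) \notin observed S t.+2.
    move=> kl kO lO; rewrite /= !inE negb_or kO /=.
    apply/existsP=> -[[o|o] /andP[_ /eqP/setP N]].
      move: (N (inr l)); rewrite !inE lO /= => /esym/eqP[El].
      by rewrite El eqxx in kl.
    by move: (N (inr k)); rewrite !inE eqxx andbF.
  have ij : i != j by apply: contraNneq xy => ->.
  by split; [apply: (leafN i j) | apply: (leafN j i); rewrite // eq_sym].
by move=> + _ E; rewrite E inE.
Qed.

(** Off the centre, a power dominating set misses at most one leaf, so of two
    such sets that differ in one vertex the larger contains every leaf. *)
Lemma star_edge_off_center (X Y : PD_TAR K) :
  adj X Y -> center \notin val X -> center \notin val Y ->
  val X = [set~ center] \/ val Y = [set~ center].
Proof.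
have half (A B : PD_TAR K) u : val B = u |: val A -> u \notin val A ->
    center \notin val B -> val B = [set~ center].
  move=> BE uA cB; apply/setP=> w; rewrite !inE.
  have [->|wc] /= := eqVneq w center; first exact/negbTE.
  apply/negPn/negP=> wB.
  have /= wu : w != u by apply: contraNneq wB => ->; rewrite BE setU11.
  have uc : u != center by apply: contraNneq cB => <-; rewrite BE setU11.
  have wA : w \notin val A by apply: contra wB; rewrite BE; apply: setU1r.
  have cA : center \notin val A by apply: contra cB; rewrite BE; apply: setU1r.
  have := star_off_center_not_power_dominating cA wA uA wc uc wu.
  by rewrite (valP A).
case/existsP=> u /orP[] /andP[uX /eqP E] cX cY; first by right; apply: (half X Y u).
left; apply: (half Y X u) => //; first by rewrite E setD1K.
by rewrite E !inE eqxx.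
Qed.

End Star.

(** * Recognising the star *)

Theorem theorem3p16 (G : sgraph) (r : nat) :
  no_isolated_vertices G ->
  3 <= r ->
  graph_iso (PD_TAR (complete_bipartite 1 r)) (PD_TAR G) ->
  graph_iso G (complete_bipartite 1 r).
Proof.
move=> isoG r3 [f [[f' fK f'K] fA]].
set K := complete_bipartite 1 r in f f' fK f'K fA *.
pose c : K := inl ord0.
have cardK : #|K| = r.+1 by rewrite card_sum !card_ord.
pose cube (A : {set 'I_r}) : {set K} := c |: inr @: A.
have cubeE A (x : K) : x \in cube A = if x is inr i then i \in A else true.
  rewrite !inE; case: x => [i|i]; first by rewrite (ord1 i) eqxx.
  by rewrite /= mem_imset //; apply: inr_inj.
have cubePD A : power_dominating (cube A).
  by apply: star_center_power_dominating; rewrite cubeE.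
pose P A : PD_TAR K := tar_vertex (cubePD A).
have PE A : val (P A) = cube A by [].
have cardG : #|G| = r.+1.
  have x : G.
    have /andP[/set0Pn/sigW[x _] _] := valP (f (P set0)); exact: x.
  have f'A X Y : adj (f' X) (f' Y) = adj X Y by rewrite -fA !f'K.
  apply/eqP; rewrite -cardK eqn_leq.
  rewrite (order_le_of_tar_iso x isoG (can_inj f'K) f'A).
  by rewrite (order_le_of_tar_iso c _ (can_inj fK) fA) //; apply/star_no_isolated/ltnW/ltnW.
have P_inj : injective P.
  by move=> A B /(congr1 val)/= E; apply/setP=> i; have /setP/(_ (inr i)) := E; rewrite !cubeE.
have [s s_inj sE] : exists2 s : 'I_r -> G, injective s & forall A x,
    (x \in val (f (P A))) = (x \in val (f (P set0))) (+) (x \in s @: A).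
  apply: (@cube_embedding _ _ (fun A => val (f (P A)))).
    by move=> A B /val_inj/(can_inj fK)/P_inj.
  move=> A i; apply/tar_adjP; rewrite fA; apply/tar_adjP; exists (inr i).
  by apply/setP=> x; rewrite !PE [RHS]inE !cubeE; case: x => [j|j] //; rewrite inE.
have [v Ev] : exists v, ~: (s @: setT) = [set v].
  apply/cards1P; rewrite -(eqn_add2l #|s @: [set: 'I_r]|) cardsC cardG.
  by rewrite card_imset // cardsT card_ord addn1.
have sv i : s i != v.
  have : s i \notin ~: (s @: setT) by rewrite inE negbK imset_f.
  by rewrite Ev inE.
have sS x : x != v -> exists i, x = s i.
  move=> xv; have : x \notin ~: (s @: setT) by rewrite Ev inE.
  by rewrite inE negbK => /imsetP[i _ ->]; exists i.
have imv A : v \in s @: A = false.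
  by apply/negbTE/imsetP=> -[i _ E]; have := sv i; rewrite E eqxx.
(* The subset of leaves whose image agrees with X away from v. *)
pose code (X : {set G}) := [set i | (s i \in X) (+) (s i \in val (f (P set0)))].
have codeE (X : {set G}) x : x != v -> (x \in X) = (x \in val (f (P (code X)))).
  case/sS=> i ->; rewrite sE (mem_imset _ _ s_inj) inE.
  by case: (s i \in X); case: (_ \in _).
have vB : v \in val (f (P set0)).
  apply/negPn/negP=> vB.
  have /andP[/set0Pn[x]] := valP (f (P (code set0))).
  have [->|xv] := eqVneq x v; last by rewrite -codeE ?inE.
  by rewrite sE imv (negPf vB).
have imageE (X : {set G}) : v \in X -> X = val (f (P (code X))).
  move=> vX; apply/setP=> x; have [->|xv] := eqVneq x v; last exact: codeE.
  by rewrite sE imv vB vX.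
have offc (X : PD_TAR G) : v \notin val X -> c \notin val (f' X).
  apply: contra => cX; pose A := [set i | (inr i : K) \in val (f' X)].
  have -> : X = f (P A).
    rewrite -[X in X = _]f'K; congr f; apply: val_inj; apply/setP=> x.
    by rewrite PE cubeE; case: x => [o|i]; rewrite ?(ord1 o) ?inE.
  by rewrite sE imv vB.
have notPD u w : u != v -> w != v -> u != w ->
    ~~ power_dominating (~: [set v; u; w]).
  move=> uv wv uw; apply/negP=> PD3.
  have pd (S : {set G}) : ~: [set v; u; w] \subset S -> power_dominating S.
    by move/power_dominatingS; apply.
  have PD1 : power_dominating [set~ v] by apply: power_dominating_setC1.
  have PDu : power_dominating (~: [set v; u]) by apply: pd; rewrite setCS subsetUl.
  have PDw : power_dominating (~: [set v; w]).
    by apply: pd; rewrite setCS setUAC subsetUl.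
  pose X1 : PD_TAR G := tar_vertex PD1; pose Xu : PD_TAR G := tar_vertex PDu.
  pose Xw : PD_TAR G := tar_vertex PDw; pose X3 : PD_TAR G := tar_vertex PD3.
  have edge1 : adj (f' X1) (f' Xu).
    rewrite -fA !f'K; apply/tar_adjP; exists u; apply/setP=> x; rewrite !inE.
    by case: (eqVneq x u) => [->|]; rewrite ?(negPf uv) // orbF.
  have edge2 : adj (f' Xw) (f' X3).
    rewrite -fA !f'K; apply/tar_adjP; exists u; apply/setP=> x; rewrite !inE.
    by case: (eqVneq x u) => [->|]; rewrite ?(negPf uv) ?(negPf uw) // orbF.
  (* Both edges end at the set of all leaves, yet w tells their ends apart. *)
  have meet X Y : val (f' X) = [set~ c] -> val (f' Y) = [set~ c] -> val X = val Y.
    by move=> EX EY; congr val; apply: (can_inj f'K); apply: val_inj; rewrite EX EY.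
  have v1 : c \notin val (f' X1) by apply: offc; rewrite !inE eqxx.
  have vu : c \notin val (f' Xu) by apply: offc; rewrite !inE eqxx.
  have vw : c \notin val (f' Xw) by apply: offc; rewrite !inE eqxx.
  have v3 : c \notin val (f' X3) by apply: offc; rewrite !inE eqxx.
  have differ (X Y : PD_TAR G) : w \in val X -> w \notin val Y -> val X <> val Y.
    by move=> wX wY E; rewrite -E wX in wY.
  have w1 : w \in val X1 by rewrite !inE.
  have wu : w \in val Xu by rewrite !inE negb_or wv eq_sym.
  have ww : w \notin val Xw by rewrite !inE eqxx orbT.
  have w3 : w \notin val X3 by rewrite !inE eqxx orbT.
  case: (star_edge_off_center edge1 v1 vu) => E1;
    case: (star_edge_off_center edge2 vw v3) => E2;
    by apply: (differ _ _ _ _ (meet _ _ E1 E2)).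
have PDv : power_dominating [set v].
  by rewrite [[set v]]imageE ?set11 //; apply: valP.
have G4 : 3 < #|G| by rewrite cardG.
have adjE := star_of_power_dominating_sets isoG G4 PDv notPD.
pose h (x : K) : G := if x is inr i then s i else v.
have h_inj : injective h.
  move=> [i|i] [j|j] //=; first by rewrite (ord1 i) (ord1 j).
  - by move=> E; have := sv j; rewrite -E eqxx.
  - by move=> E; have := sv i; rewrite E eqxx.
  - by move/s_inj->.
have [h' hK h'K] : bijective h by apply: inj_card_bij; rewrite // cardG cardK.
exists h'; split; first by exists h.
have hA (x y : K) : adj (h x) (h y) = adj x y.
  by rewrite adjE; case: x => i; case: y => j; rewrite /= ?eqxx ?(negPf (sv _)).
by move=> x y; rewrite -hA !h'K.
Qed.
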